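(* A countable Polish Clifford semigroup $S$ embeds topologically into $\mathbb{N}^{\mathbb{N}}$ if and only if $S$ is ditopological and the semilattice $E(S)$ embeds topologically into $\mathbb{N}^{\mathbb{N}}$.
   Context: An inverse semigroup is a semigroup $S$ such that for each $x\in S$ there is a unique $x^{-1}\in S$ with $xx^{-1}x=x$ and $x^{-1}xx^{-1}=x^{-1}$. It is Clifford if $xx^{-1}=x^{-1}x$ for all $x\in S$. $E(S)=\{e\in S: e^2=e\}$ is the semilattice (commutative semigroup of idempotents) of idempotents of $S$, with the subspace topology. A topological semigroup is a semigroup with a topology for which multiplication is continuous (such a topology is called a semigroup topology). A Polish Clifford semigroup is a Clifford semigroup with a Polish (completely metrizable and separable) semigroup topology. An inverse semigroup $S$ with a semigroup topology is called ditopological if inversion is continuous and for any point $x\in S$ and any neighbourhood $O$ of $x$ there are neighbourhoods $U$ and $W$ of $x$ and $xx^{-1}$, respectively, such that $$\{s\in S : \exists b\in U,\ \exists e\in W\cap E(S)\text{ such that } b=es\}\cap\{s\in S : ss^{-1}\in W\}\subseteq O.$$ $\mathbb{N}^{\mathbb{N}}$ is the monoid of all functions $\mathbb{N}\to\mathbb{N}$ under composition (functions act on the right and compose from left to right), with the product topology arising from the discrete topology on $\mathbb{N}$. An embedding of semigroups is an injective homomorphism; an embedding $\phi:S\to T$ of topological semigroups is topological if both $\phi$ and $\phi^{-1}:(S)\phi\to S$ are continuous, where $(S)\phi$ has the subspace topology. ''$S$ embeds topologically into $T$'' means such a topological embedding exists. *)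

(* Defs.v *)
From HB Require Import structures.
From mathcomp Require Import all_boot monoid all_order all_algebra.
From mathcomp Require Import all_classical all_reals topology.

Set Implicit Arguments.
Unset Strict Implicit.
Unset Printing Implicit Defensive.

Local Open Scope classical_set_scope.
Local Open Scope group_scope.

HB.mixin Record isTopologicalSemigroup S & Topological S & Semigroup S := {
  mulg_continuous : continuous (fun p : S * S => p.1 * p.2)
}.

#[short(type="topologicalSemigroupType")]
HB.structure Definition TopologicalSemigroup :=
  { S of isTopologicalSemigroup S & Topological S & Semigroup S }.

(* The inverse [x^-1] of MathComp's [baseGroupType] presupposes a unit, whence *)
(* a separate operation.                                                      *)
HB.mixin Record Semigroup_isInverse S & Semigroup S := {
  sinv : S -> S ;
  mulg_sinvK : forall x, x * sinv x * x = x ;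
  sinv_mulgK : forall x, sinv x * x * sinv x = sinv x ;
  sinv_unique : forall x y, x * y * x = x -> y * x * y = y -> y = sinv x
}.

#[short(type="inverseSemigroupType")]
HB.structure Definition InverseSemigroup :=
  { S of Semigroup_isInverse S & Semigroup S }.

(* Only the multiplication is assumed continuous, not [sinv]. *)
#[short(type="inverseTopologicalSemigroupType")]
HB.structure Definition InverseTopologicalSemigroup :=
  { S of TopologicalSemigroup S & InverseSemigroup S }.

Definition clifford (S : inverseSemigroupType) : Prop :=
  forall x : S, x * sinv x = sinv x * x.

Definition idempotents (S : inverseSemigroupType) : set S :=
  [set e | e * e = e].

Section idempotents_theory.
Variable S : inverseSemigroupType.
Implicit Types e f : S.

Lemma sinv_idem e : idempotents e -> sinv e = e.
Proof. by move=> ee; apply/esym/sinv_unique; rewrite ee. Qed.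

Lemma idempotentsM e f :
  idempotents e -> idempotents f -> idempotents (e * f).
Proof.
rewrite /idempotents /= => ee ff; set i := sinv (e * f).
have efi : e * f * i * (e * f) = e * f by exact: mulg_sinvK.
have ief : i * (e * f) * i = i by exact: sinv_mulgK.
(* [f * i * e] is another inverse of [e * f] *)
have Ei : f * i * e = i.
  apply: sinv_unique.
    by rewrite -!mulgA (mulgA e e) ee (mulgA f f) ff; rewrite !mulgA -mulgA efi.
  rewrite -[in RHS]ief !mulgA.
  by rewrite -(mulgA (f * i) e e) ee -(mulgA (f * i * e) f f) ff.
have ii : i * i = i.
  rewrite -{1}Ei -{2}Ei.
  have -> : f * i * e * (f * i * e) = f * (i * (e * f) * i) * e.
    by rewrite !mulgA.
  by rewrite ief.
have -> : e * f = i; last by [].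
rewrite -[RHS]sinv_idem //.
by apply: sinv_unique.
Qed.

End idempotents_theory.

(* The semilattice E(S), with the induced multiplication and the subspace     *)
(* (initial) topology of the inclusion into S.                                *)
Definition semilattice (S : inverseSemigroupType) : Type :=
  set_type (@idempotents S).

Section semilattice_semigroup.
Variable S : inverseSemigroupType.
Local Notation E := (semilattice S).

HB.instance Definition _ := Choice.copy E (set_type (@idempotents S)).

Definition semilattice_mul (e f : E) : E :=
  exist _ (val e * val f)
    (mem_set (idempotentsM (set_valP e) (set_valP f))).

Lemma semilattice_mulA : associative semilattice_mul.
Proof. by move=> e f g; apply/val_inj; rewrite /= mulgA. Qed.

HB.instance Definition _ := isSemigroup.Build E semilattice_mulA.

End semilattice_semigroup.

Section semilattice_topology.
Variable S : inverseTopologicalSemigroupType.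
Local Notation E := (semilattice S).

HB.instance Definition _ := Topological.copy E (set_type (@idempotents S)).

Lemma semilattice_mul_continuous : continuous (fun p : E * E => p.1 * p.2).
Proof.
have val_cts : continuous (val : E -> S) by exact: initial_continuous.
have mul_cts : continuous (fun p : E * E => (val p.1 : S) * val p.2).
  move=> p; apply: (@continuous_comp _ _ _
    (fun q : E * E => (val q.1 : S, val q.2 : S)) (fun q : S * S => q.1 * q.2)).
    apply: cvg_pair => /=.
      by apply: (continuous_comp _ (@val_cts p.1)); exact: cvg_fst.
    by apply: (continuous_comp _ (@val_cts p.2)); exact: cvg_snd.
  exact: mulg_continuous.
by apply/continuousP => _ [B oB <-]; move/continuousP: mul_cts => /(_ B oB).
Qed.

HB.instance Definition _ :=
  isTopologicalSemigroup.Build E semilattice_mul_continuous.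

End semilattice_topology.

(* [nat] carries its (discrete) library topology. *)
Definition full_transf : Type := {ptws nat -> nat}.

HB.instance Definition _ :=
  Topological.copy full_transf ({ptws nat -> nat}).

(* Functions act on the right: [f * g] is "first f, then g". *)
Definition transf_mul (f g : full_transf) : full_transf := fun n => g (f n).
Definition transf_one : full_transf := fun n => n.

Lemma transf_mulA : associative transf_mul. Proof. by []. Qed.
Lemma transf_mul1 : left_id transf_one transf_mul. Proof. by []. Qed.
Lemma transf_1mul : right_id transf_one transf_mul. Proof. by []. Qed.

HB.instance Definition _ :=
  isMonoid.Build full_transf transf_mulA transf_mul1 transf_1mul.

Lemma transf_mul_continuous :
  continuous (fun p : full_transf * full_transf => p.1 * p.2).
Proof.
have nbhs_coord (f : full_transf) n : nbhs f [set g | g n = f n].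
  have := @proj_continuous nat (fun=> nat) n f.
  by move=> /(_ [set f n]); apply; exact: discrete_set1.
move=> [f g]; apply/cvg_sup => n U /= [_ [[B oB <-] Bfg] BU].
apply: (filterS BU).
exists ([set f' | f' n = f n], [set g' | g' (f n) = g (f n)]).
  by split; exact: nbhs_coord.
move=> [f' g'] /= [f'n g'n].
have fg'E : transf_mul f' g' n = transf_mul f g n.
  by rewrite /transf_mul f'n g'n.
by change (B (transf_mul f' g' n)); rewrite fg'E.
Qed.

HB.instance Definition _ :=
  isTopologicalSemigroup.Build full_transf transf_mul_continuous.

(* [psi] is the inverse of [phi] on its range, a subspace of [T]. *)
Definition topological_embedding (S T : topologicalSemigroupType)
    (phi : {multiplicative S -> T}) : Prop :=
  [/\ injective phi, continuous phi &
      exists psi : set_type (range phi) -> S,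
        (forall y, phi (psi y) = val y) /\ continuous psi].

Definition embeds_topologically (S T : topologicalSemigroupType) : Prop :=
  exists phi : {multiplicative S -> T}, topological_embedding phi.

Definition ditopological (S : inverseTopologicalSemigroupType) : Prop :=
  continuous (@sinv S) /\
  forall (x : S) (O : set S), nbhs x O ->
    exists U W : set S, [/\ nbhs x U, nbhs (x * sinv x) W &
      [set s | exists2 b, U b &
                 exists2 e, (W `&` @idempotents S) e & b = e * s]
      `&` [set s | W (s * sinv s)] `<=` O].

Definition separable (T : topologicalType) : Prop :=
  exists D : set T, countable D /\ dense D.

Definition completely_metrizable (R : realType) (T : topologicalType) : Prop :=
  exists (M : metricType R) (h : T -> M) (g : M -> T),
    [/\ cancel h g, cancel g h, continuous h, continuous g &
        forall u : nat -> M, cauchy (u @ \oo) -> exists l : M, u @ \oo --> l].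

Definition polish (R : realType) (T : topologicalType) : Prop :=
  completely_metrizable R T /\ separable T.

(* Main.v *)
Require Import Defs.
From HB Require Import structures.
From mathcomp Require Import all_boot monoid all_order all_algebra.
From mathcomp Require Import all_classical all_reals topology.

(** Embedding S topologically into the monoid of transformations of nat amounts
to letting S act from the right on a countable set of points, in such a way that
the sets of s with prescribed images of finitely many points form a base of the
topology of S ([embedding_action], [action_embedding]).

Suppose S is a Clifford semigroup with such an action. If s and t agree at a
point then so do dom s and dom t, where dom s = s s^-1 ([action_dom]). This lets
one compare s^-1 with t^-1, and b = e s with s, one point at a time, which gives
continuity of inversion and the ditopological condition. The action restricts to
the semilattice.

Conversely, suppose S is ditopological and its semilattice E acts on X. Then S
acts on X through the continuous homomorphism dom : S -> E, but this action
forgets everything about the maximal subgroups H_f. Completeness and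
countability supply what is missing, since by Baire's argument every nonempty
closed subset of S has an isolated point ([polish_isolated_point]). First, H_f
is closed, hence discrete ([maximal_subgroup_discrete]). Secondly, if a clopen
set C contains the idempotent e, then C meets the principal ideal of e at an
idempotent f that is an isolated point of its own principal ideal
([isolated_below_in]). For such an f the condition f <= dom s is clopen in s, and
S acts on the discrete set H_f with a point None adjoined: s multiplies on the
right if f <= dom s, and sends everything to None otherwise
([right_mul_or_fail]).

The action on X together with all of these generates the topology. Given a
neighbourhood O of x, take U and W as in the ditopological condition, use the
action of E to bound dom y inside W and inside {f | f x in U}, and choose f as
above in the resulting clopen class of dom x. If y moves the finitely many
points of X involved as x does, and moves f as x does, then f y = f x is in U
while f and dom y are in W, whence y is in O. *)

Set Implicit Arguments.
Unset Strict Implicit.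
Unset Printing Implicit Defensive.

Local Open Scope classical_set_scope.
Local Open Scope group_scope.

(** * Transformations of the natural numbers and right actions *)

Lemma nbhs_eval (f : full_transf) n : nbhs f [set g : full_transf | g n = f n].
Proof.
have := @proj_continuous nat (fun=> nat) n f.
by move=> /(_ [set f n]); apply; exact: discrete_set1.
Qed.

Lemma cvg_full_transf (F : set_system full_transf) (FF : Filter F)
    (f : full_transf) :
  (forall n, F [set g : full_transf | g n = f n]) -> F --> f.
Proof.
move=> Ff; apply/cvg_sup => n U /= [_ [[B oB <-] Bf] BU].
apply: (filterS BU); apply: filterS (Ff n) => g /= gn.
by change (B (g n)); rewrite gn.
Qed.

(** The sets of g agreeing with f below some N generate a filter that converges
to f coordinatewise, hence in the product topology, so it contains every
neighbourhood of f. *)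
Lemma nbhs_full_transf_sub (f : full_transf) (O : set full_transf) :
  nbhs f O ->
  exists N, forall g : full_transf,
    (forall n, (n < N)%N -> g n = f n) -> O g.
Proof.
pose B N := [set g : full_transf | forall n, (n < N)%N -> g n = f n].
pose F := filter_from [set: nat] B.
have FF : Filter F.
  apply: filter_from_filter; first by exists 0%N.
  move=> M N _ _; exists (maxn M N) => // g gE.
  by split=> n nN; apply: gE; rewrite leq_max nN ?orbT.
suff Ff : F --> f by move=> /Ff[N _ BN]; exists N.
by apply: cvg_full_transf => n; exists n.+1 => // g; exact.
Qed.

(** A right action on X, regarded as a discrete set, for which the finite
intersections of the sets {t | a x t = a x s} form a base of neighbourhoods of
s. *)
Definition topological_action (S : topologicalSemigroupType) (X : choiceType)
    (a : X -> S -> X) : Prop :=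
  [/\ forall x s t, a x (s * t) = a (a x s) t,
      forall x s, nbhs s [set t | a x t = a x s] &
      forall (s : S) (O : set S), nbhs s O ->
        exists xs : seq X, forall t, {in xs, forall x, a x t = a x s} -> O t].

Lemma nbhs_action (S : topologicalSemigroupType) (X : choiceType)
    (a : X -> S -> X) (xs : seq X) (s : S) :
  topological_action a -> nbhs s [set t | {in xs, forall x, a x t = a x s}].
Proof.
move=> [_ a_loc _]; elim: xs => [|x xs IHxs]; first by apply: filterE.
apply: filterS (filterI (a_loc x s) IHxs) => t [/= tx txs] y.
by rewrite inE => /predU1P[->//|]; exact: txs.
Qed.

Lemma embedding_action (S : topologicalSemigroupType) :
  embeds_topologically S full_transf ->
  exists a : nat -> S -> nat, topological_action a.
Proof.
move=> [phi [phi_inj phi_cts [psi [psiK psi_cts]]]].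
exists (fun n s => phi s n); split.
- by move=> n s t; rewrite gmulfM.
- by move=> n s; exact: (phi_cts s _ (nbhs_eval (phi s) n)).
- move=> s O sO; pose y : range phi := exist _ (phi s) (mem_set (imageT phi s)).
  have psiy : psi y = s by apply: phi_inj; rewrite psiK.
  have [_ [[B oB <-] By BO]] : nbhs y (psi @^-1` O).
    by apply: psi_cts; rewrite psiy.
  have [N NB] : exists N, forall g : full_transf,
      (forall n, (n < N)%N -> g n = phi s n) -> B g.
    by apply: nbhs_full_transf_sub; apply: open_nbhs_nbhs.
  exists (iota 0 N) => t tN.
  pose z : range phi := exist _ (phi t) (mem_set (imageT phi t)).
  have psiz : psi z = t by apply: phi_inj; rewrite psiK.
  rewrite -psiz; apply: BO; apply: NB => n nN.
  by apply: tN; rewrite mem_iota.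
Qed.

(** The action is carried to nat along an injective coding of X; the numbers that
code no point are fixed by every element of S. *)
Lemma action_embedding (S : topologicalSemigroupType) (X : choiceType)
    (a : X -> S -> X) :
  accessible_space S -> countable [set: X] -> topological_action a ->
  embeds_topologically S full_transf.
Proof.
move=> S_T1 /countable_injP[c /in2TT c_inj] [a_act a_loc a_gen].
pose phi (s : S) : full_transf := fun n =>
  if pselect (exists x, c x = n) is left h then c (a (projT1 (cid h)) s) else n.
have phi_code s x : phi s (c x) = c (a x s).
  rewrite /phi; case: pselect => [h|]; last by case; exists x.
  by case: cid => y /= /c_inj ->.
have phi_out s n : (forall x, c x <> n) -> phi s n = n.
  by rewrite /phi; case: pselect => // -[x xn] /(_ x).
have phiM : {morph phi : s t / s * t}.
  move=> s t; apply/funext => n.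
  change (phi (s * t) n = phi t (phi s n)).
  case: (pselect (exists x, c x = n)) => [[x <-]|nx].
    by rewrite !phi_code a_act.
  have {}nx x : c x <> n by move=> xn; apply: nx; exists x.
  by rewrite !phi_out.
have phi_loc s t x : phi t (c x) = phi s (c x) -> a x t = a x s.
  by rewrite !phi_code => /c_inj.
have phi_inj : injective phi.
  (* The base determined by the action separates points of a T1 space. *)
  move=> s t st; apply/eqP; apply: contrapT => /negP/S_T1[A [oA]].
  rewrite !inE => As; apply.
  have [xs xsA] : exists xs : seq X,
      forall t, {in xs, forall x, a x t = a x s} -> A t.
    by apply: a_gen; exact: open_nbhs_nbhs.
  by apply: xsA => x _; apply: phi_loc; rewrite st.
pose Phi : {multiplicative S -> full_transf} :=
  HB.pack phi (isMultiplicative.Build S full_transf phi phiM).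
exists Phi; split => //.
- move=> s; apply: cvg_full_transf => n.
  have [[x <-]|nx] := pselect (exists x, c x = n).
    by apply: filterS (a_loc x s) => t /= tx; rewrite !phi_code tx.
  have {}nx x : c x <> n by move=> xn; apply: nx; exists x.
  by apply: (@filterE _ (nbhs s)) => t; rewrite /= !phi_out.
- pose psi (y : range phi) : S := s2val (cid2 (set_valP y)).
  have psiK y : phi (psi y) = val y by rewrite /psi; case: cid2.
  exists psi; split => [y|y O yO]; first exact: psiK.
  have [xs xsO] := a_gen _ _ yO.
  have val_cts : continuous (val : range phi -> full_transf).
    exact: initial_continuous.
  have loc_val : nbhs (val y) [set g : full_transf |
      {in xs, forall x, g (c x) = val y (c x)}].
    elim: (xs) => [|x xs' IHxs]; first by apply: filterE.
    apply: filterS (filterI (nbhs_eval (val y) (c x)) IHxs) => g [/= gx gxs] z.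
    by rewrite inE => /predU1P[->//|]; exact: gxs.
  have yxs : nbhs y (val @^-1` _) := val_cts y _ loc_val.
  apply: (@filterS _ (nbhs y) _ _ _ _ yxs) => z /= zxs.
  by apply: xsO => x /zxs; rewrite -!psiK; exact: phi_loc.
Qed.

(** * Inverse and Clifford semigroups *)

Lemma cvg_mulg (S : topologicalSemigroupType) (T : Type) (F : set_system T)
    (FF : Filter F) (f g : T -> S) (x y : S) :
  f @ F --> x -> g @ F --> y -> (fun t => f t * g t) @ F --> x * y.
Proof.
move=> fx gy.
apply: (cvg_comp (fun t => (f t, g t)) (fun p : S * S => p.1 * p.2)).
  exact: cvg_pair fx gy.
exact: (@mulg_continuous S (x, y)).
Qed.

Lemma nbhs_mulgl (S : topologicalSemigroupType) (x y : S) (O : set S) :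
  nbhs (x * y) O -> nbhs y [set t | O (x * t)].
Proof. exact: (cvg_mulg _ (cvg_cst x) cvg_id). Qed.

Lemma nbhs_mulgr (S : topologicalSemigroupType) (x y : S) (O : set S) :
  nbhs (x * y) O -> nbhs x [set t | O (t * y)].
Proof. exact: (cvg_mulg _ cvg_id (cvg_cst y)). Qed.

Section inverse_semigroup.
Variable S : inverseSemigroupType.
Implicit Types e f s t x y : S.

Lemma idempotentsC e f :
  idempotents e -> idempotents f -> e * f = f * e.
Proof.
move=> ee ff; have ef := idempotentsM ee ff; have fe := idempotentsM ff ee.
rewrite -[LHS](sinv_idem ef); apply/esym/sinv_unique.
  by rewrite !mulgA -(mulgA e f f) ff -(mulgA (e * f) e e) ee -mulgA ef.
by rewrite !mulgA -(mulgA f e e) ee -(mulgA (f * e) f f) ff -mulgA fe.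
Qed.

Definition dom s := s * sinv s.

Lemma dom_idem s : idempotents (dom s).
Proof. by rewrite /idempotents /= /dom !mulgA mulg_sinvK. Qed.

Lemma mul_dom s : dom s * s = s.
Proof. exact: mulg_sinvK. Qed.

Lemma dom_id e : idempotents e -> dom e = e.
Proof. by move=> ee; rewrite /dom (sinv_idem ee). Qed.

Lemma domC s t : dom s * dom t = dom t * dom s.
Proof. by apply: idempotentsC; exact: dom_idem. Qed.

Lemma sinvK s : sinv (sinv s) = s.
Proof.
by apply/esym/sinv_unique; [exact: sinv_mulgK|exact: mulg_sinvK].
Qed.

Lemma sinv_mul_idem s : idempotents (sinv s * s).
Proof. by rewrite /idempotents /= !mulgA sinv_mulgK. Qed.

(** The idempotents t t^-1 and s^-1 s commute, so t^-1 s^-1 satisfies the two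
equations that characterize the inverse of s t. *)
Lemma sinvM s t : sinv (s * t) = sinv t * sinv s.
Proof.
have C : dom t * (sinv s * s) = sinv s * s * dom t.
  by apply: idempotentsC; [exact: dom_idem|exact: sinv_mul_idem].
apply/esym/sinv_unique.
  have -> : s * t * (sinv t * sinv s) * (s * t)
      = s * (dom t * (sinv s * s)) * t by rewrite /dom !mulgA.
  by rewrite C /dom !mulgA mulg_sinvK -!mulgA (mulgA t) mulg_sinvK.
have -> : sinv t * sinv s * (s * t) * (sinv t * sinv s)
    = sinv t * (sinv s * s * dom t) * sinv s by rewrite /dom !mulgA.
by rewrite -C /dom !mulgA sinv_mulgK -!mulgA (mulgA (sinv s)) sinv_mulgK.
Qed.

Hypothesis S_clifford : clifford S.

(** The Clifford condition for e s reads e s s^-1 = s^-1 e s; multiplying by s on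
the left gives e s = s e. *)
Lemma idem_central e s : idempotents e -> e * s = s * e.
Proof.
move=> ee.
have es : e * dom s = sinv s * e * s.
  have := S_clifford (e * s); rewrite sinvM (sinv_idem ee).
  rewrite !mulgA -(mulgA (sinv s) e e) ee => <-.
  have eds : e * dom s = dom s * e by apply: idempotentsC (dom_idem s).
  by rewrite -(mulgA e s) -/(dom s) eds -[RHS]mulgA ee.
have -> : e * s = s * (sinv s * e * s).
  rewrite !mulgA -/(dom s) (idempotentsC (dom_idem s) ee).
  by rewrite -mulgA mul_dom.
rewrite -es (idempotentsC ee (dom_idem s)) mulgA; congr (_ * e).
by rewrite /dom S_clifford mulgA mulg_sinvK.
Qed.

Lemma dom_central s t : dom s * t = t * dom s.
Proof. exact: (idem_central t (dom_idem s)). Qed.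

Lemma domM s t : dom (s * t) = dom s * dom t.
Proof.
rewrite [LHS]/dom sinvM -mulgA (mulgA t) -/(dom t).
rewrite (dom_central t (sinv s)) mulgA.
by rewrite -/(dom s).
Qed.

End inverse_semigroup.

(** * Topological actions of Clifford semigroups *)

Section embedded_clifford.
Variables (S : inverseTopologicalSemigroupType) (X : choiceType).
Variable (a : X -> S -> X).
Hypotheses (S_clifford : clifford S) (a_top : topological_action a).

(** If u and v agree at n then n v v^-1 = n u v^-1, and the right-hand side is
fixed by dom u, as dom u is central and dom u u = u. Hence n (dom u) (dom v) =
n (dom v); as u and v play symmetric roles and dom u, dom v commute, n (dom u) =
n (dom v). *)
Lemma action_dom n x y : a n y = a n x -> a n (dom y) = a n (dom x).
Proof.
case: a_top => a_act _ _.
suff H u v : a n u = a n v -> a n (dom u * dom v) = a n (dom v).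
  by move=> yx; rewrite -(H y x yx) -(H x y (esym yx)) domC.
move=> uv; have vE : a n (dom v) = a n (u * sinv v) by rewrite !a_act uv.
rewrite domC a_act vE -a_act -(dom_central S_clifford).
by rewrite mulgA mul_dom.
Qed.

(** Let m = n x^-1. If y agrees with x at n and at m then, by [action_dom],
n y^-1 = n (dom y) y^-1 = n (dom x) y^-1 = m x y^-1 = m y y^-1 = m (dom y)
= m (dom x) = m. *)
Lemma action_sinv_continuous : continuous (@sinv S).
Proof.
case: (a_top) => a_act a_loc a_gen x O /a_gen[xs xsO].
pose ys := [seq a n (sinv x) | n <- xs].
apply: (@filterS _ (nbhs x) _ _ _ _
  (filterI (nbhs_action xs x a_top) (nbhs_action ys x a_top))).
move=> y [/= yxs yys]; apply: xsO => n nxs.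
have yinv : dom y * sinv y = sinv y by rewrite /dom S_clifford sinv_mulgK.
have xinv : sinv x * dom x = sinv x by rewrite /dom mulgA sinv_mulgK.
have ny : a (a n (sinv x)) y = a (a n (sinv x)) x by rewrite yys ?map_f.
rewrite /= -yinv a_act (action_dom (yxs n nxs)).
rewrite /dom S_clifford a_act -ny -a_act -/(dom y).
by rewrite (action_dom ny) -a_act xinv.
Qed.

(** If b = e s with b close to x, and with e and dom s both close to dom x, then
n x = n b = n e s = n (dom s) s = n s at each of the finitely many points n. *)
Lemma action_ditopological : ditopological S.
Proof.
split=> [|x O xO]; first exact: action_sinv_continuous.
have [a_act _ a_gen] := a_top; have [xs xsO] := a_gen _ _ xO.
exists [set b | {in xs, forall n, a n b = a n x}].
exists [set w | {in xs, forall n, a n w = a n (dom x)}].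
split; [exact: nbhs_action|exact: nbhs_action|].
move=> s [[b bxs [e [exs _] be]] /= sxs]; apply: xsO => n nxs.
rewrite -(bxs n nxs) be -[in LHS](mul_dom s).
by rewrite (a_act n (dom s) s) (sxs n nxs) (a_act n e s) exs.
Qed.

Lemma action_semilattice :
  topological_action (fun n (e : semilattice S) => a n (val e)).
Proof.
have [a_act a_loc a_gen] := a_top.
have val_cts : continuous (val : semilattice S -> S).
  exact: initial_continuous.
split=> [n e f|n e|e O [_ [[B oB <-] Be BO]]].
- exact: a_act.
- exact: (val_cts e _ (a_loc n (val e))).
- have [xs xsB] : exists xs : seq X,
      forall t, {in xs, forall n, a n t = a n (val e)} -> B t.
    by apply: a_gen; apply: open_nbhs_nbhs.
  by exists xs => f fxs; apply: BO; exact: xsB.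
Qed.

End embedded_clifford.

Lemma accessible_semilattice (S : inverseTopologicalSemigroupType) :
  accessible_space S -> accessible_space (semilattice S).
Proof.
move=> S_T1 e f ef; have [A [oA eA fA]] := S_T1 (val e) (val f) ef.
exists (val @^-1` A); split.
- by exists A.
- by move: eA; rewrite !inE.
- by move: fA; rewrite !inE.
Qed.

(** * Isolated points of countable complete spaces *)

Section baire.
Local Open Scope ring_scope.
Import Order.TTheory GRing.Theory Num.Theory.

Lemma expr2V_lt (R : archiRealFieldType) (e : R) :
  0 < e -> exists N, 2 ^- N < e.
Proof.
move=> e0; exists (Num.bound e^-1).
rewrite -[ltRHS]invrK ltf_pV2 ?posrE ?invr_gt0 ?exprn_gt0 //.
apply: lt_trans (archi_boundP _) _; first by rewrite invr_ge0 ltW.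
by rewrite -natrX ltr_nat ltn_expl.
Qed.

(** Without an isolated point in A, one can shrink a closed ball centred at a
point of A to a closed ball, again centred in A, that avoids any prescribed
point. Avoiding the points of M one after the other gives a nested sequence of
closed balls whose centres converge to a point of A that lies in every ball, and
so is none of the points of M. *)
Lemma isolated_point_metric (R : realType) (M : metricType R) (A : set M) :
  (forall u : nat -> M, cauchy (u @ \oo) -> exists l : M, u @ \oo --> l) ->
  countable [set: M] -> closed A -> A !=set0 ->
  exists2 x, A x & nbhs x [set y | A y -> y = x].
Proof.
move=> M_complete /countable_injP[c /in2TT c_inj] A_closed [x0 Ax0].
apply: contrapT => no_isolated.
have dense x e : A x -> 0 < e -> exists y, [/\ A y, mdist x y < e & y <> x].
  move=> Ax e0; apply: contrapT => noy; apply: no_isolated; exists x => //.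
  apply: filterS (nbhsx_ballx x e e0) => y; rewrite ballEmdist /= => xy Ay.
  by apply: contrapT => yx; apply: noy; exists y.
have step (n : nat) (p : M * R) : exists q : M * R, A p.1 -> 0 < p.2 ->
    [/\ A q.1, 0 < q.2 <= p.2 / 2,
        forall z, mdist q.1 z <= q.2 -> mdist p.1 z <= p.2 &
        forall z, mdist q.1 z <= q.2 -> c z <> n].
  case: p => x r; have [[Ax r0]|nAr] := pselect (A x /\ 0 < r); last first.
    by exists (x, r) => /= Ax r0; case: nAr.
  have r20 : 0 < r / 2 by rewrite divr_gt0.
  have [y [Ay xy cy]] : exists y, [/\ A y, mdist x y < r / 2 & c y <> n].
    have [xn|xn] := eqVneq (c x) n; last first.
      by exists x; split=> //; [rewrite mdistxx|exact/eqP].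
    have [y [Ay xy yx]] := dense x (r / 2) Ax r20.
    by exists y; split=> //; rewrite -xn => /c_inj.
  have [[s sn]|ns] := pselect (exists s, c s = n); last first.
    exists (y, r / 2) => _ _ /=; split=> //; first by rewrite r20 lexx.
      move=> z yz; rewrite (le_trans (metric_triangle x y z)) //.
      by rewrite [leRHS]splitr lerD // ltW.
    by move=> z _ zn; apply: ns; exists z.
  have ys : 0 < mdist y s.
    by rewrite mdist_gt0; apply/eqP => ys; apply: cy; rewrite ys.
  exists (y, Num.min (r / 2) (mdist y s / 2)) => _ _ /=; split=> //.
  - by rewrite lt_min r20 divr_gt0 //= ge_min lexx.
  - move=> z; rewrite le_min => /andP[yz _].
    rewrite (le_trans (metric_triangle x y z)) //.
    by rewrite [leRHS]splitr lerD // ltW.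
  - move=> z; rewrite le_min => /andP[_ yz] zn.
    move: yz; have -> : z = s by apply: c_inj; rewrite zn sn.
    by rewrite leNgt ltr_pdivrMr // ltr_pMr // ltr1n.
(* [p n] is the centre and radius of the n-th closed ball; [p n.+1] avoids the
   point with code n. *)
have [next nextP] := choice (fun np : nat * (M * R) => step np.1 np.2).
pose p := nat_rect (fun=> (M * R)%type) (x0, 1) (fun n q => next (n, q)).
have pP n : A (p n).1 /\ 0 < (p n).2.
  elim: n => [|n [An rn]] //.
  by have [? /andP[? ?] _ _] := nextP (n, p n) An rn.
have pS n := nextP (n, p n) (proj1 (pP n)) (proj2 (pP n)).
have nested m k z : mdist (p (k + m)%N).1 z <= (p (k + m)%N).2 ->
    mdist (p m).1 z <= (p m).2.
  elim: k => [//|k IHk] kz; apply: IHk.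
  by have [_ _ + _] := pS (k + m)%N; exact.
have close m n : (m <= n)%N -> mdist (p m).1 (p n).1 <= (p m).2.
  move=> /subnK mn; apply: (nested m (n - m)%N); rewrite mn mdistxx.
  by have [_ /ltW] := pP n.
have radius n : (p n).2 <= 2 ^- n.
  elim: n => [|n IHn]; first by rewrite expr0 invr1.
  have [_ /andP[_ rn] _ _] := pS n; apply: le_trans rn _.
  by rewrite exprS invfM mulrC ler_pM2l ?invr_gt0.
have [l pl] : exists l : M, (fun n => (p n).1) @ \oo --> l.
  apply: M_complete; apply: cauchy_exP => e e0.
  have [N Ne] := expr2V_lt e0.
  exists (p N).1; exists N => // n /= Nn; rewrite ballEmdist /=.
  by rewrite (le_lt_trans (close N n Nn)) // (le_lt_trans (radius N)).
have Al : A l.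
  apply: A_closed => B /pl[N _ NB]; exists (p N).1.
  by split; [case: (pP N)|exact: (NB N (leqnn N))].
have lp n : mdist (p n).1 l <= (p n).2.
  apply/ler_addgt0Pr => e e0.
  have /pl[N _ Ne] := nbhsx_ballx l e e0.
  have := Ne (maxn N n) (leq_maxl _ _).
  rewrite ballEmdist /= metric_sym => le.
  rewrite (le_trans (metric_triangle _ (p (maxn N n)).1 _)) //.
  by rewrite lerD ?(ltW le) // close // leq_maxr.
by have [_ _ _ /(_ l (lp (c l).+1))] := pS (c l).
Qed.

End baire.

Lemma polish_isolated_point (R : realType) (T : topologicalType) (A : set T) :
  completely_metrizable R T -> countable [set: T] ->
  closed A -> A !=set0 -> exists2 x, A x & nbhs x [set y | A y -> y = x].
Proof.
move=> [M [h [g [hK gK h_cts g_cts M_complete]]]].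
move=> /countable_injP[c /in2TT c_inj] A_closed [x0 Ax0].
have [x Ax x_isolated] : exists2 x, A (g x) &
    nbhs x [set y | A (g y) -> y = x].
  apply: (isolated_point_metric (A := g @^-1` A) M_complete).
  - by apply/countable_injP; exists (c \o g) => x y _ _ /= /c_inj /(can_inj gK).
  - by have /continuous_closedP/(_ A A_closed) := g_cts.
  - by exists (h x0); rewrite /preimage /= hK.
exists (g x) => //.
have : nbhs (h (g x)) [set y | A (g y) -> y = x] by rewrite gK.
move=> /(h_cts (g x)) xx.
apply: (@filterS _ (nbhs (g x)) _ _ _ _ xx) => y /= yx Ay.
by rewrite -(hK y) yx ?hK.
Qed.

Lemma metrizable_hausdorff (R : realType) (T : topologicalType) :
  completely_metrizable R T -> hausdorff_space T.
Proof.
move=> [M [h [g [hK gK h_cts g_cts _]]]] x y xy; apply: (can_inj hK).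
apply: (@metric_hausdorff R M) => A B hxA hyB.
have [z [zA zB]] := xy _ _ (h_cts x _ hxA) (h_cts y _ hyB).
by exists (h z).
Qed.

Lemma closed_equalizer (T U : topologicalType) (f g : T -> U) :
  hausdorff_space U -> continuous f -> continuous g ->
  closed [set t | f t = g t].
Proof.
move=> U_T2 f_cts g_cts t cl_t; apply: U_T2 => A B ftA gtB.
have fA : nbhs t (f @^-1` A) := f_cts t _ ftA.
have gB : nbhs t (g @^-1` B) := g_cts t _ gtB.
have [s [/= fgs [As Bs]]] := cl_t _ (filterI fA gB).
by exists (f s); split; [|rewrite fgs].
Qed.

(** * The action of a ditopological Clifford semigroup *)

Section action_of_clifford.
Variables (S : inverseTopologicalSemigroupType) (X : choiceType).
Hypotheses (S_clifford : clifford S) (S_T2 : hausdorff_space S).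
Hypothesis S_isolated : forall A : set S, closed A -> A !=set0 ->
  exists2 x, A x & nbhs x [set y | A y -> y = x].
Hypothesis S_ditop : ditopological S.
Variable a : X -> semilattice S -> X.
Hypothesis a_top : topological_action a.

Lemma dom_continuous : continuous (@dom S).
Proof.
by move=> s; apply: cvg_mulg; [exact: cvg_id|exact: (proj1 S_ditop)].
Qed.

Definition domE (s : S) : semilattice S :=
  exist _ (dom s) (mem_set (dom_idem s)).

Lemma domE_continuous : continuous domE.
Proof. apply: continuous_comp_initial; exact: dom_continuous. Qed.

Lemma domEM s t : domE (s * t) = domE s * domE t.
Proof. by apply: val_inj; rewrite /= domM. Qed.

(** The fiber of dom over dom h is a closed subset, so it has an isolated point
x; left translation by x h^-1 maps this group onto itself and h to x. *)
Lemma maximal_subgroup_discrete (h : S) :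
  nbhs h [set t | dom t = dom h -> t = h].
Proof.
have [x xh x_isolated] : exists2 x, dom x = dom h &
    nbhs x [set t | dom t = dom h -> t = x].
  apply: (S_isolated (A := [set t | dom t = dom h])); last by exists h.
  apply: closed_equalizer => //; first exact: dom_continuous.
  by move=> t; exact: cvg_cst.
have xE : x * sinv h * h = x.
  by rewrite -mulgA -S_clifford -/(dom h) -xh -(dom_central S_clifford) mul_dom.
rewrite -[in X in nbhs X _]xE in x_isolated.
apply: filterS (nbhs_mulgl x_isolated) => t /= tx th.
have dom_sinv (u : S) : dom (sinv u) = dom u by rewrite /dom sinvK S_clifford.
have {}tx : x * sinv h * t = x.
  apply: tx; rewrite !(domM S_clifford) dom_sinv xh th.
  by rewrite !dom_idem.
have : h * sinv x * (x * sinv h * t) = h * sinv x * x by rewrite tx.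
rewrite -mulgA -[RHS]mulgA -S_clifford -/(dom x) xh -(dom_central S_clifford).
rewrite mul_dom => <-.
rewrite !mulgA -(mulgA h) -S_clifford -/(dom x) xh.
by rewrite -(dom_central S_clifford) mul_dom -/(dom h) -th mul_dom.
Qed.

(** An isolated point of its own principal ideal. By continuity of g |-> f g, the
filter of all g >= f is then open. *)
Definition isolated_below (f : S) :=
  nbhs f [set g | idempotents g -> f * g = g -> g = f].

(** An isolated point f of the closed set of idempotents of C below e will do: an
idempotent near f and below f is still in C and below e. *)
Lemma isolated_below_in (C : set S) (e : S) :
  closed C -> open C -> C e -> idempotents e ->
  exists f, [/\ C f, idempotents f, e * f = f & isolated_below f].
Proof.
move=> C_closed C_open Ce ee.
pose A := C `&` ([set t | t * t = t] `&` [set t | e * t = t]).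
have [f [Cf [ff ef]] f_isolated] : exists2 f, A f &
    nbhs f [set g | A g -> g = f].
  apply: S_isolated; last by exists e.
  apply: (closedI C_closed (closedI _ _)); apply: closed_equalizer => // t.
  - by apply: cvg_mulg; exact: cvg_id.
  - exact: cvg_id.
  - by apply: cvg_mulg; [exact: cvg_cst|exact: cvg_id].
  - exact: cvg_id.
exists f; split=> //.
have fC : nbhs f C by exact: open_nbhs_nbhs.
apply: filterS (filterI fC f_isolated) => g [/= Cg gf] gg fg.
by apply: gf; split=> //; split=> //=; rewrite -fg mulgA ef.
Qed.

(** For h in the maximal subgroup H_f, where f = dom h, the condition
h * dom s = h says that f <= dom s, and then h * s is again in H_f. Thus one
formula describes the actions on all the sets H_f with None adjoined, where None
serves as a common zero. *)
Definition right_mul_or_fail (h : option S) (s : S) : option S :=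
  if h is Some h then
    if `[< isolated_below (dom h) /\ h * dom s = h >] then Some (h * s)
    else None
  else None.

Definition sum_action (p : X + option S) (s : S) : X + option S :=
  match p with
  | inl x => inl (a x (domE s))
  | inr h => inr (right_mul_or_fail h s)
  end.

Lemma dom_mul_fix (h s : S) : h * dom s = h -> dom (h * s) = dom h.
Proof.
move=> hs; rewrite -[in RHS]hs [LHS](domM S_clifford) [RHS](domM S_clifford).
by rewrite (dom_id (dom_idem s)).
Qed.

Lemma mul_domM_fix (h s t : S) :
  h * dom (s * t) = h <-> h * dom s = h /\ h * dom t = h.
Proof.
rewrite (domM S_clifford) mulgA; split=> [hst|[-> ->//]].
have hs : h * dom s = h.
  rewrite -[in LHS]hst -[LHS]mulgA (domC t s) [LHS]mulgA.
  by rewrite -(mulgA h (dom s)) dom_idem hst.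
by split=> //; rewrite -[in LHS]hs hst.
Qed.

Lemma right_mul_or_failM h s t :
  right_mul_or_fail h (s * t) = right_mul_or_fail (right_mul_or_fail h s) t.
Proof.
case: h => [h|//] /=.
case: asboolP => [[h_iso /mul_domM_fix[hs ht]]|nst].
  rewrite asboolT //=.
  have dhs := dom_mul_fix hs.
  rewrite asboolT; first by rewrite mulgA.
  rewrite dhs; split=> //.
  by rewrite -[LHS]mulgA -(dom_central S_clifford t s) [LHS]mulgA ht.
case: asboolP => [[h_iso hs]|//] /=.
have dhs := dom_mul_fix hs.
rewrite asboolF // dhs => -[_ hst]; apply: nst; split=> //.
apply/mul_domM_fix; split=> //.
have : h * s * dom t * sinv s = h * s * sinv s by rewrite hst.
rewrite -(mulgA (h * s)) (dom_central S_clifford) mulgA.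
by rewrite -(mulgA h s (sinv s)) -/(dom s) hs.
Qed.

(** Near s the condition f <= dom t keeps its truth value: it is closed by
continuity, and open because f is isolated below. When it holds, h * t stays in
the discrete group H_f. *)
Lemma right_mul_or_fail_locally_constant (h : option S) (s : S) :
  nbhs s [set t | right_mul_or_fail h t = right_mul_or_fail h s].
Proof.
case: h => [h|]; last exact: filterE.
rewrite /right_mul_or_fail.
have [h_iso|h_niso] := pselect (isolated_below (dom h)); last first.
  by apply: filterE => t /=; do 2! [rewrite asboolF; last by case].
have [hs|hs] := pselect (h * dom s = h); last first.
  have : \forall t \near s, h * dom t <> h.
    have hs_open : open (~` [set t | h * dom t = h]).
      apply: closed_openC; apply: closed_equalizer => // t.
      + by apply: cvg_mulg; [exact: cvg_cst|exact: dom_continuous].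
      + exact: cvg_cst.
    exact: (open_nbhs_nbhs (conj hs_open hs)).
  by apply: filterS => t ht /=; do 2! [rewrite asboolF; last by case].
have dhs : dom h * dom s = dom h by rewrite -domM // dom_mul_fix.
have near_dom : \forall t \near s, h * dom t = h.
  rewrite /isolated_below -[X in nbhs X _]dhs in h_iso.
  have sdom : nbhs s (@dom S @^-1` _) := dom_continuous (nbhs_mulgl h_iso).
  apply: (@filterS _ (nbhs s) _ _ _ _ sdom) => t /= ht.
  have {}ht : dom h * dom t = dom h.
    apply: ht; last by rewrite mulgA dom_idem.
    by apply: idempotentsM; exact: dom_idem.
  by rewrite -(dom_central S_clifford) -[in LHS](mul_dom h) mulgA (domC t) ht
    mul_dom.
have near_mul : \forall t \near s, dom (h * t) = dom (h * s) -> h * t = h * s.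
  exact: nbhs_mulgl (maximal_subgroup_discrete (h * s)).
apply: filterS (filterI near_dom near_mul) => t [/= ht hts].
by do 2! [rewrite asboolT //]; rewrite hts // !dom_mul_fix.
Qed.

Lemma sum_action_topological : topological_action sum_action.
Proof.
have [a_act a_loc a_gen] := a_top; split=> [p s t|p s|x O xO].
- case: p => [x|h] /=; first by rewrite domEM a_act.
  by rewrite right_mul_or_failM.
- case: p => [x|h] /=.
    have sdom : nbhs s (domE @^-1` _) := domE_continuous (a_loc x (domE s)).
    by apply: (@filterS _ (nbhs s) _ _ _ _ sdom) => t /= ->.
  by apply: filterS (right_mul_or_fail_locally_constant h s) => t /= ->.
have [U [W [xU xW UWO]]] := proj2 S_ditop x O xO.
(* [V] bounds both dom y and the idempotent f chosen below. *)
pose V := W `&` [set f | U (f * x)].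
have xV : nbhs (dom x) V.
  by apply: filterI => //; apply: nbhs_mulgr; rewrite mul_dom.
have val_cts : continuous (val : semilattice S -> S).
  exact: initial_continuous.
have [xs xsV] := a_gen _ _ (val_cts (domE x) _ xV).
pose C := [set t | {in xs, forall n, a n (domE t) = a n (domE x)}].
have [f [Cf ff xf f_iso]] : exists f,
    [/\ C f, idempotents f, dom x * f = f & isolated_below f].
  have near_const t : nbhs t
      [set s | {in xs, forall n, a n (domE s) = a n (domE t)}].
    exact: (domE_continuous (nbhs_action xs (domE t) a_top)).
  have Cx : C (dom x).
    by move=> n _; congr (a n _); apply: val_inj; exact: dom_id (dom_idem x).
  apply: isolated_below_in Cx (dom_idem x).
  - move=> t /(_ _ (near_const t))[s [Cs st]] n nxs.
    by rewrite -st ?Cs.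
  - rewrite openE => t Ct; apply: filterS (near_const t) => s st n nxs.
    by rewrite st ?Ct.
have domEf : val (domE f) = f by exact: dom_id.
have Vf : V f by rewrite -domEf; apply: xsV.
(* The point f of H_f records f y, because it is the identity of that group. *)
exists (inr (Some f) :: [seq inl n | n <- xs]) => y yxs.
have Vy : V (dom y).
  apply: (xsV (domE y)) => n nxs.
  have : inl n \in inr (Some f) :: [seq inl n | n <- xs].
    by rewrite inE map_f.
  by move=> /yxs[].
have fy : f * y = f * x.
  have := yxs (inr (Some f)); rewrite mem_head => /(_ isT) /=.
  rewrite (dom_id ff) [X in _ = _ (if X then _ else _)]asboolT.
    by case: asboolP => // _ [].
  by split=> //; rewrite -(dom_central S_clifford).
apply: UWO; split; last by case: Vy.
by exists (f * x); [case: Vf|exists f => //; case: Vf].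
Qed.

End action_of_clifford.

Local Close Scope group_scope.

Theorem theorem2p9 (R : realType) (S : inverseTopologicalSemigroupType)
    (S_clifford : clifford S) (S_polish : polish R S)
    (S_countable : countable [set: S]) :
  embeds_topologically S full_transf <->
  ditopological S /\ embeds_topologically (semilattice S) full_transf.
Proof.
have [S_metrizable _] := S_polish.
have S_T2 := metrizable_hausdorff S_metrizable.
have S_T1 := hausdorff_accessible S_T2.
split=> [/embedding_action[a a_top]|[S_ditop /embedding_action[a a_top]]].
  split; first exact: action_ditopological S_clifford a_top.
  apply: (action_embedding _ _ (action_semilattice a_top)).
    exact: accessible_semilattice.
  exact: countableP.
have S_isolated A := @polish_isolated_point R S A S_metrizable S_countable.
apply: (action_embedding S_T1 _
  (sum_action_topological S_clifford S_T2 S_isolated S_ditop a_top)).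
have /countable_injP[c /in2TT c_inj] := S_countable.
apply/countable_injP.
exists (fun p => pickle (match p with
  | inl n => inl n | inr h => inr (omap c h) end : nat + option nat)).
move=> p q _ _ /(pcan_inj pickleK).
case: p q => [n|[h|]] [m|[k|]] //; first by case=> ->.
by case=> /c_inj ->.
Qed.
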